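(* Let $(\gamma_j)_{j\ge 1}$ be a sequence of reals with $1\ge\gamma_1\ge\gamma_2\ge\cdots\ge 0$, and consider the associated product weights $\gamma_{\mathfrak u}=\prod_{j\in\mathfrak u}\gamma_j$. The following assertions are equivalent: (1) the centered regular grid with different mesh-sizes achieves quasi polynomial tractability (QPT) for the $\boldsymbol\gamma$-weighted star discrepancy; (2) it achieves polynomial tractability (PT); (3) it achieves strong polynomial tractability (SPT); (4) the sequence $(\gamma_j)_{j\ge1}$ is eventually zero, i.e. there is $\tau$ with $\gamma_j=0$ for all $j>\tau$.
   Context: For $d\in\mathbb N$ write $[d]=\{1,\dots,d\}$. For mesh-sizes $m_1,\dots,m_d\in\mathbb N$, the centered regular grid is $\Gamma_{m_1,\dots,m_d}=\{(\frac{2\ell_1+1}{2m_1},\dots,\frac{2\ell_d+1}{2m_d}) : \ell_j\in\{0,1,\dots,m_j-1\}\text{ for } j=1,\dots,d\}$, an $N$-point set with $N=m_1\cdots m_d$. For an $N$-point set $\mathcal P_d\subset[0,1)^d$ with real coefficients $\mathcal A(\mathcal P_d)=\{a_{\boldsymbol x}:\boldsymbol x\in\mathcal P_d\}$, the local discrepancy is $\Delta_{\mathcal P_d,\mathcal A(\mathcal P_d)}(\boldsymbol\alpha)=\sum_{\boldsymbol x\in\mathcal P_d}a_{\boldsymbol x}\mathbf 1_{[\boldsymbol 0,\boldsymbol\alpha)}(\boldsymbol x)-\prod_{j=1}^d\alpha_j$ for $\boldsymbol\alpha\in[0,1]^d$, where $[\boldsymbol 0,\boldsymbol\alpha)=[0,\alpha_1)\times\cdots\times[0,\alpha_d)$.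 Given weights $\gamma_{\mathfrak u}\in[0,1]$, the $\boldsymbol\gamma$-weighted star discrepancy is $D^*_{N,\boldsymbol\gamma}(\mathcal P_d,\mathcal A(\mathcal P_d))=\sup_{\boldsymbol\alpha\in[0,1]^d}\max_{\emptyset\ne\mathfrak u\subseteq[d]}\gamma_{\mathfrak u}|\Delta_{\mathcal P_d,\mathcal A(\mathcal P_d)}((\boldsymbol\alpha_{\mathfrak u},\boldsymbol 1))|$, where $(\boldsymbol\alpha_{\mathfrak u},\boldsymbol 1)=(y_1,\dots,y_d)$ with $y_j=\alpha_j$ for $j\in\mathfrak u$ and $y_j=1$ otherwise. For $\varepsilon\in(0,1)$, $d\in\mathbb N$, let $N_{\boldsymbol\gamma}(\varepsilon,d)=\min\{N: N=m_1\cdots m_d \text{ and there exist coefficients } \mathcal A(\Gamma_{m_1,\dots,m_d}) \text{ with } D^*_{N,\boldsymbol\gamma}(\Gamma_{m_1,\dots,m_d},\mathcal A(\Gamma_{m_1,\dots,m_d}))\le\varepsilon\}$. QPT means there exist $C,t>0$ with $N_{\boldsymbol\gamma}(\varepsilon,d)\le C\exp(t(1+\log d)(1+\log\varepsilon^{-1}))$ for all $d\in\mathbb N$, $\varepsilon\in(0,1)$. PT means there exist $C,\tau>0$ and $\sigma\ge0$ with $N_{\boldsymbol\gamma}(\varepsilon,d)\le C\varepsilon^{-\tau}d^{\sigma}$ for all $d\in\mathbb N$, $\varepsilon\in(0,1)$; SPT means this holds with $\sigma=0$. *)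

(* Defs.v *)
From HB Require Import structures.
From mathcomp Require Import all_boot all_order all_algebra.
From mathcomp Require Import all_classical all_reals all_analysis.
Unset Printing Implicit Defensive.
Import Order.TTheory GRing.Theory Num.Theory.
Local Open Scope ring_scope.
Local Open Scope classical_set_scope.

Section Disc.

Context {R : realType}.

(* Coordinates are indexed by j : 'I_d, standing for j+1 in [d] = {1,...,d}.
   The weight sequence gamma : nat -> R is indexed from 1 (gamma 0 is unused);
   coordinate j : 'I_d carries the weight gamma j.+1. *)

Definition prod_weight (gamma : nat -> R) {d : nat} (u : {set 'I_d}) : R :=
  \prod_(j in u) gamma j.+1.

(* Grid indices: ell : 'I_d -> 'I_N with N = m_1 ... m_d; only those with
   ell_j < m_j are grid points. *)
Definition Nof {d : nat} (m : 'I_d -> nat) : nat := \prod_(j < d) m j.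

Definition in_grid {d : nat} (m : 'I_d -> nat)
  (ell : {ffun 'I_d -> 'I_(Nof m)}) : bool :=
  [forall j, (ell j < m j)%N].

Definition grid_pt {d : nat} (m : 'I_d -> nat)
  (ell : {ffun 'I_d -> 'I_(Nof m)}) (j : 'I_d) : R :=
  ((2 * ell j + 1)%:R) / ((2 * m j)%:R).

Definition in_box {d : nat} (x y : 'I_d -> R) : bool :=
  [forall j, (0 <= x j) && (x j < y j)].

Definition local_disc {d : nat} (m : 'I_d -> nat)
  (a : {ffun 'I_d -> 'I_(Nof m)} -> R) (y : 'I_d -> R) : R :=
  \sum_(ell | in_grid m ell) a ell * (in_box (grid_pt m ell) y)%:R
  - \prod_(j < d) y j.

Definition restr_one {d : nat} (u : {set 'I_d}) (alpha : 'I_d -> R) : 'I_d -> R :=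
  fun j => if j \in u then alpha j else 1.

Definition wstar_disc (gamma : nat -> R) {d : nat} (m : 'I_d -> nat)
  (a : {ffun 'I_d -> 'I_(Nof m)} -> R) : R :=
  sup [set r | exists alpha : 'I_d -> R, exists u : {set 'I_d},
        (forall j, 0 <= alpha j <= 1) /\ u != finset.set0 /\
        r = prod_weight gamma u * `| local_disc m a (restr_one u alpha) | ].

Definition admissible (gamma : nat -> R) (eps : R) (d N : nat) : Prop :=
  exists m : 'I_d -> nat, (forall j, (0 < m j)%N) /\ N = Nof m /\
    exists a : {ffun 'I_d -> 'I_(Nof m)} -> R, wstar_disc gamma m a <= eps.

(* "N_gamma(eps, d) <= B", where N_gamma(eps,d) is the minimum of the
   admissible N (and +infinity if there are none). *)
Definition N_le (gamma : nat -> R) (eps : R) (d : nat) (B : R) : Prop :=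
  exists N, admissible gamma eps d N /\ (N%:R <= B).

Definition QPT (gamma : nat -> R) : Prop :=
  exists C t : R, 0 < C /\ 0 < t /\
    forall (d : nat) (eps : R), (1 <= d)%N -> 0 < eps < 1 ->
      N_le gamma eps d
        (C * expR (t * (1 + ln (d%:R)) * (1 + ln (eps^-1)))).

Definition PT (gamma : nat -> R) : Prop :=
  exists C tau sigma : R, 0 < C /\ 0 < tau /\ 0 <= sigma /\
    forall (d : nat) (eps : R), (1 <= d)%N -> 0 < eps < 1 ->
      N_le gamma eps d (C * eps `^ (- tau) * (d%:R) `^ sigma).

Definition SPT (gamma : nat -> R) : Prop :=
  exists C tau : R, 0 < C /\ 0 < tau /\
    forall (d : nat) (eps : R), (1 <= d)%N -> 0 < eps < 1 ->
      N_le gamma eps d (C * eps `^ (- tau)).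

End Disc.

(* Main.v *)
Require Import Defs.
From HB Require Import structures.
From mathcomp Require Import all_boot all_order all_algebra.
From mathcomp Require Import all_classical all_reals all_analysis.
From mathcomp Require Import lra.
Import Order.TTheory GRing.Theory Num.Theory.
Local Open Scope ring_scope.

(* If gamma_j = 0 for j > k, the grid with mesh-size M in the first k directions
   and 1 in the others, with equal coefficients 1/N, has a local discrepancy that
   is a difference of two products; telescoping bounds it by k/(2M), and since
   N <= M^k this gives SPT.  Conversely, a discrepancy at most eps forces
   m_j >= gamma_j / (2 eps) for every j, hence N >= c_d eps^(-d) with c_d > 0 when
   no weight vanishes.  For fixed d and eps tending to 0, QPT then yields
   d <= t (1 + log d) for every d, which is absurd. *)

(** * Products and midpoint counts *)

(** Factors are exchanged one at a time; the others lie in [[0, 1]] and so never enlarge the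
    difference. *)
Lemma distr_prod_le_sum {R : realDomainType} {I : Type} (s : seq I) (F G : I -> R) :
  (forall i, 0 <= F i <= 1) -> (forall i, 0 <= G i <= 1) ->
  `|\prod_(i <- s) F i - \prod_(i <- s) G i| <= \sum_(i <- s) `|F i - G i|.
Proof.
move=> F01 G01; elim: s => [|i s IHs]; first by rewrite !big_nil subrr normr0.
rewrite !big_cons.
set p := \prod_(j <- s) F j in IHs *; set q := \prod_(j <- s) G j in IHs *.
have -> : F i * p - G i * q = (F i - G i) * p + G i * (p - q).
  by rewrite mulrBl mulrBr addrA subrK.
apply: le_trans (ler_normD _ _) _; rewrite !normrM lerD //.
  have /andP[p0 p1] : 0 <= p <= 1.
    by rewrite prodr_ge0 ?prodr_ile1 // => j _; have /andP[] := F01 j.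
  by rewrite ler_piMr // ger0_norm.
have /andP[g0 g1] := G01 i.
by rewrite ger0_norm //; apply: le_trans IHs; rewrite ler_piMl.
Qed.

(** Counting the midpoints [l + 1/2] below [z] rounds [z] to a nearest integer. *)
Lemma count_midpoints_approx {R : realFieldType} (m : nat) (z : R) : 0 <= z <= m%:R ->
  `|\sum_(l < m) ((2 * l + 1)%:R < 2 * z)%R%:R - z| <= 1 / 2.
Proof.
elim: m => [|m IHm] /andP[z0 zm].
  by rewrite big_ord0 (le_anti (introT andP (conj zm z0))) subrr normr0 divr_ge0.
rewrite big_ord_recr /=.
have [zm'|mz] := leP z m%:R.
  rewrite (_ : (_ < 2 * z) = false) ?addr0; first by apply: IHm; rewrite z0.
  by apply/negbTE; rewrite -leNgt natrD natrM; lra.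
rewrite (eq_bigr (fun=> 1)) => [|l _]; last first.
  rewrite (_ : (_ < 2 * z)) //; have : l.+1%:R <= m%:R :> R by rewrite ler_nat.
  by rewrite natrD natrM -addn1 natrD; lra.
rewrite sumr_const card_ord ler_norml; move: zm; rewrite -natr1 natrD natrM.
by case: ltP => /=; lra.
Qed.

(** Distribution function of the uniform measure on the [m] midpoints; the inequality is strict
    because the test boxes are half-open. *)
Definition grid_cdf {R : realType} (m : nat) (y : R) : R :=
  (\sum_(l < m) ((2 * l + 1)%:R / (2 * m)%:R < y)%R%:R) / m%:R.

Lemma grid_cdf_itv {R : realType} (m : nat) (y : R) : 0 <= grid_cdf m y <= 1.
Proof.
rewrite /grid_cdf; case: m => [|m]; first by rewrite big_ord0 mul0r lexx ler01.
rewrite divr_ge0 ?sumr_ge0 // ler_pdivrMr ?ltr0n // mul1r.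
rewrite -[in leRHS](card_ord m.+1) -sumr_const.
by apply: ler_sum => l _; case: ltP.
Qed.

Lemma grid_cdf_approx {R : realType} (m : nat) (y : R) : (0 < m)%N -> 0 <= y <= 1 ->
  `|grid_cdf m y - y| <= (2 * m%:R)^-1.
Proof.
move=> m0 /andP[y0 y1]; have m0' : 0 < m%:R :> R by rewrite ltr0n.
have /count_midpoints_approx : 0 <= y * m%:R <= m%:R.
  by rewrite mulr_ge0 ?ler_piMl // ltW.
rewrite (eq_bigr (fun l : 'I_m => ((2 * l + 1)%:R / (2 * m)%:R < y)%R%:R)) => [H|l _]; last first.
  by rewrite ltr_pdivrMr ?ltr0n ?muln_gt0 // natrM mulrCA.
rewrite -(ler_pM2r m0') -{1}[m%:R]gtr0_norm // -normrM mulrBl /grid_cdf divfK ?gt_eqF //.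
by rewrite invfM divfK ?gt_eqF // -[2^-1]div1r.
Qed.

(** Makes a direction of mesh-size 1 free of error when its corner coordinate is [1]. *)
Lemma grid_cdf1 {R : realType} : grid_cdf 1 1 = 1 :> R.
Proof.
rewrite /grid_cdf big_ord1 divr1 muln0 add0n muln1.
by rewrite ltr_pdivrMr ?ltr0n // mul1r ltr_nat.
Qed.

(** Equal coefficients and box indicators both split over the coordinates, so the sum over the grid
    is a product of one-dimensional sums. *)
Lemma local_disc_uniform {R : realType} {d : nat} (m : 'I_d -> nat) (y : 'I_d -> R) :
  (forall j, 0 < m j)%N ->
  local_disc m (fun=> (Nof m)%:R^-1) y = \prod_j grid_cdf (m j) (y j) - \prod_j y j.
Proof.
move=> m0; congr (_ - _).
(* Grid indices live in ['I_(Nof m)], so each one-dimensional sum is widened to that range before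
   the product of sums is expanded. *)
have mN j : (m j <= Nof m)%N.
  by rewrite /Nof (bigD1 j) //= leq_pmulr // prodn_gt0.
rewrite (eq_bigr (fun j => \sum_(l < Nof m | (l < m j)%N)
    ((2 * l + 1)%:R / (2 * m j)%:R < y j)%R%:R / (m j)%:R)) => [|j _]; last first.
  by rewrite /grid_cdf (big_ord_widen _
    (fun l => ((2 * l + 1)%:R / (2 * m j)%:R < y j)%R%:R) (mN j)) mulr_suml.
rewrite bigA_distr_big_dep; apply: eq_big => [ell|ell _]; first exact: eq_forallb.
rewrite prodf_div mulrC {2}/Nof natr_prod; congr (_ / _).
rewrite -(big_morph (fun b : bool => b%:R : R) (id2 := true) (op2 := andb)) //; last first.
  by case=> -[]; rewrite ?mul1r ?mul0r.
rewrite big_andE; congr (nat_of_bool _)%:R; apply: eq_forallb => j.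
by rewrite /grid_pt divr_ge0.
Qed.

(** * Lower and upper bounds for the weighted discrepancy *)

Section Weighted.
Context {R : realType} {gamma : nat -> R}.
Hypothesis gamma01 : forall j, 0 <= gamma j.+1 <= 1.

Lemma prod_weight_itv {d : nat} (u : {set 'I_d}) : 0 <= prod_weight gamma u <= 1.
Proof.
by rewrite prodr_ge0 ?prodr_ile1 // => j _; case/andP: (gamma01 j).
Qed.

Lemma wstar_disc_ge {d : nat} (m : 'I_d -> nat) (a : {ffun 'I_d -> 'I_(Nof m)} -> R)
    (alpha : 'I_d -> R) (u : {set 'I_d}) :
  (forall j, 0 <= alpha j <= 1) -> u != finset.set0 ->
  prod_weight gamma u * `|local_disc m a (restr_one u alpha)| <= wstar_disc gamma m a.
Proof.
move=> alpha01 u0; apply: ub_le_sup; last by exists alpha, u.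
(* [sup] is known to dominate the set once the set is bounded: here by the sum of the [|a ell|] plus
   a volume of at most 1. *)
exists (\sum_(ell | in_grid m ell) `|a ell| + 1) => _ [b [v [b01 [v0 ->]]]].
have /andP[w0 w1] := prod_weight_itv v.
apply: le_trans (_ : `|local_disc m a (restr_one v b)| <= _).
  by rewrite ler_piMl.
apply: le_trans (ler_normB _ _) _; apply: lerD.
  apply: le_trans (ler_norm_sum _ _ _) _; apply: ler_sum => ell _.
  by rewrite normrM normr_nat ler_piMr //; case: in_box.
have y01 j : 0 <= restr_one v b j <= 1.
  by rewrite /restr_one; case: ifP => // _; rewrite ler01 lexx.
rewrite ger0_norm ?prodr_ile1 // prodr_ge0 // => j _; by case/andP: (y01 j).
Qed.

(* No grid point has its j-th coordinate below 1 / (2 m_j), so there the local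
   discrepancy is minus the volume, whatever the coefficients. *)
Lemma mesh_size_ge {d : nat} (m : 'I_d -> nat) (a : {ffun 'I_d -> 'I_(Nof m)} -> R)
    (eps : R) (j : 'I_d) :
  (0 < m j)%N -> wstar_disc gamma m a <= eps -> gamma j.+1 / 2 <= eps * (m j)%:R.
Proof.
move=> m0 weps.
have m0' : 0 < (m j)%:R :> R by rewrite ltr0n.
have h01 : 0 <= ((2 * m j)%:R^-1 : R) <= 1.
  by rewrite invr_ge0 ler0n invf_le1 ?ler1n ?ltr0n muln_gt0 m0.
(* With [u] the singleton of [j], all other coordinates become 1 and the volume is just
   [1 / (2 m_j)]. *)
have u0 : [set j]%SET != finset.set0 by apply/set0Pn; exists j; rewrite inE.
have := wstar_disc_ge m a (fun=> (2 * m j)%:R^-1) _ (fun=> h01) u0.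
rewrite /prod_weight big_set1 /local_disc big1 => [|ell _]; last first.
  rewrite (_ : in_box _ _ = false) ?mulr0 //; apply/negbTE/forallPn; exists j.
  rewrite /restr_one inE eqxx /grid_pt negb_and -leNgt; apply/orP; right.
  by rewrite ler_peMl ?ler1n ?addn1 // invr_ge0.
rewrite (bigD1 j) //= big1 => [|i ij]; last first.
  by rewrite /restr_one inE (negbTE ij).
rewrite /restr_one inE eqxx mulr1 sub0r normrN ger0_norm; last by case/andP: h01.
move=> /le_trans /(_ weps); rewrite -(ler_pM2r m0'); apply: le_trans.
by rewrite natrM invfM mulrA mulfVK // gt_eqF.
Qed.

Lemma sum_lt_indicator_le (d k : nat) : (\sum_(j < d) (j < k) <= k)%N.
Proof.
elim: d k => [|d IHd] [|k]; rewrite ?big_ord0 //; first by rewrite big1.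
by rewrite big_ord_recl -[leqRHS]add1n leq_add //; exact: IHd.
Qed.

Lemma Nof_cutoff_le (M d k : nat) : (0 < M)%N ->
  (Nof (fun j : 'I_d => M ^ (j < k))%N <= M ^ k)%N.
Proof. by move=> M0; rewrite /Nof -expn_sum leq_pexp2l // sum_lt_indicator_le. Qed.

(** A set [u] reaching beyond the first [k] directions has weight 0. For any other [u], the later
    directions are exact, having mesh-size [M ^ 0 = 1] and corner coordinate 1, and each of the
    first [k] costs at most [1 / (2 M)]. *)
Lemma wstar_disc_cutoff_le (M d k : nat) (m := fun j : 'I_d => (M ^ (j < k))%N) :
  (0 < M)%N -> (0 < d)%N -> (forall j, (k < j)%N -> gamma j = 0) ->
  wstar_disc gamma m (fun=> (Nof m)%:R^-1) <= k%:R / (2 * M%:R).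
Proof.
move=> M0 d0 gk.
have m0 j : (0 < m j)%N by rewrite expn_gt0 M0.
apply: ge_sup.
  (* Bounding a [sup] from above requires a nonempty set; [d0] supplies a nonempty [u]. *)
  exists (prod_weight gamma [set: 'I_d]%SET *
    `|local_disc m (fun=> (Nof m)%:R^-1) (restr_one [set: 'I_d]%SET (fun=> 0))|).
  exists (fun=> 0), [set: 'I_d]%SET; split; first by move=> j; rewrite lexx ler01.
  by split=> //; apply/set0Pn; exists (Ordinal d0); rewrite inE.
move=> _ [alpha [u [alpha01 [_ ->]]]].
have [/existsP[j /andP[ju kj]]|/existsPn uk] := boolP [exists j, (j \in u) && (k <= j)%N].
  by rewrite /prod_weight (bigD1 j) //= gk // !mul0r divr_ge0 // mulr_ge0.
have /andP[w0 w1] := prod_weight_itv u.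
apply: le_trans (_ : `|local_disc m (fun=> (Nof m)%:R^-1) (restr_one u alpha)| <= _).
  by rewrite ler_piMl.
have y01 j : 0 <= restr_one u alpha j <= 1.
  by rewrite /restr_one; case: ifP => // _; rewrite ler01 lexx.
rewrite local_disc_uniform //.
apply: le_trans (distr_prod_le_sum _ _ _ (fun=> grid_cdf_itv _ _) y01) _.
apply: le_trans (_ : \sum_(j < d) (j < k)%:R / (2 * M%:R) <= _); last first.
  by rewrite -mulr_suml ler_pM2r ?invr_gt0 ?mulr_gt0 ?ltr0n // -natr_sum ler_nat sum_lt_indicator_le.
apply: ler_sum => j _; rewrite /m; case: ltnP => [jk|kj] /=.
  by rewrite mul1r expn1 grid_cdf_approx.
rewrite /restr_one; have := uk j; rewrite kj andbT => /negbTE ->.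
by rewrite expn0 grid_cdf1 subrr normr0 mul0r.
Qed.

Lemma eventually_zero_SPT (k : nat) : (forall j, (k < j)%N -> gamma j = 0) -> SPT gamma.
Proof.
(* SPT asks for a positive exponent, and the exponent will be [k]. *)
wlog k0 : k / (0 < k)%N.
  move=> W gk; apply: (W k.+1) => // j kj; apply: gk; exact: ltnW.
move=> gk; exists ((k%:R + 1) ^+ k), k%:R.
rewrite exprn_gt0 ?addr_gt0 ?ltr0n //; split=> //; split=> // d eps d0 /andP[e0 e1].
(* [M] exceeds [k / eps], so that [k / (2 M) <= eps], but is at most [(k + 1) / eps], since rounding
   up costs at most [1 <= 1 / eps]. *)
pose M := (Num.truncn (k%:R / eps)).+1.
have kM : k%:R / eps < M%:R by exact: truncnS_gt.
have Mk : M%:R <= (k%:R + 1) / eps.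
  rewrite /M -natr1 mulrDl lerD //; first by rewrite truncn_le divr_ge0 // ltW.
  by rewrite mul1r invf_ge1 // ltW.
exists (Nof (fun j : 'I_d => M ^ (j < k))%N); split; last first.
  rewrite powRN powR_mulrn ?(ltW e0) // -exprVn -exprMn.
 apply: le_trans (_ : ((M ^ k)%:R : R) <= _); first by rewrite ler_nat Nof_cutoff_le.
  by rewrite natrX lerXn2r ?nnegrE ?divr_ge0 ?(ltW e0) ?addr_ge0.
exists (fun j : 'I_d => (M ^ (j < k))%N).
split=> [j|]; first by rewrite expn_gt0.
split=> //; exists (fun=> (Nof (fun j : 'I_d => M ^ (j < k))%N)%:R^-1).
apply: le_trans (wstar_disc_cutoff_le _ _ _ _ d0 gk) _ => //.
rewrite ler_pdivrMr ?mulr_gt0 ?ltr0n //.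
move: kM; rewrite ltr_pdivrMr // mulrC => /ltW /le_trans; apply.
by rewrite ler_pM2l // ler_peMl // ler1n.
Qed.

Lemma admissible_size_ge (eps : R) (d N : nat) : 0 < eps -> admissible gamma eps d N ->
  \prod_(j < d) (gamma j.+1 / 2 / eps) <= N%:R.
Proof.
move=> e0 [m [m0 [-> [a ha]]]]; rewrite /Nof natr_prod; apply: ler_prod => j _.
have /andP[g0 _] := gamma01 j.
rewrite !divr_ge0 ?(ltW e0) //= ler_pdivrMr // [leRHS]mulrC; exact: mesh_size_ge ha.
Qed.

(* At fixed d, letting eps = exp (- x) with x large compares the exponents of eps^-1. *)
Lemma QPT_dim_le (C t : R) (d : nat) :
  0 < C -> (forall j, 0 < gamma j.+1) ->
  (forall eps, 0 < eps < 1 ->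
    N_le gamma eps d (C * expR (t * (1 + ln d%:R) * (1 + ln eps^-1)))) ->
  d%:R <= t * (1 + ln d%:R).
Proof.
move=> C0 gpos H; set s := t * (1 + ln d%:R); rewrite leNgt; apply/negP => sd.
pose G := \prod_(j < d) (gamma j.+1 / 2).
have G0 : 0 < G by apply: prodr_gt0 => j _; rewrite divr_gt0.
pose B := C * expR s / G.
have B0 : 0 <= B by rewrite divr_ge0 ?(ltW G0) // mulr_ge0 ?expR_ge0 // ltW.
(* The assumed bound will reduce to [exp ((d - s) x) <= B]. This [x] makes the exponent [B + 1],
   contradicting [1 + y <= exp y]. *)
pose x := (B + 1) / (d%:R - s).
have x0 : 0 < x by rewrite divr_gt0 ?subr_gt0 // ltr_wpDl.
have e01 : 0 < expR (- x) < 1 by rewrite expR_gt0 expR_lt1 oppr_lt0.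
have [N [adm NB]] := H _ e01.
have := le_trans (admissible_size_ge _ _ _ (expR_gt0 _) adm) NB.
rewrite -expRN opprK expRK mulrDr mulr1 expRD mulrA.
rewrite big_split /= prodr_const card_ord -/G -expRM_natl.
rewrite mulrC -ler_pdivlMr // mulrAC -/B -ler_pdivrMr ?expR_gt0 // -expRN -expRD.
move=> /(le_trans (expR_ge1Dx _)).
have -> : d%:R * x - t * (1 + ln d%:R) * x = B + 1.
  by rewrite -mulrBl -/s /x mulrC divfK // subr_eq0 gt_eqF.
by rewrite leNgt ltr_pwDl ?lerDl.
Qed.

End Weighted.

(** * Growth comparison and the cycle of implications *)

(** For [d = n^2] with [n >= 1], [1 + log d = 1 + 2 log n < 3 n], so any [n > 3 t] works. *)
Lemma linear_gt_log {R : realType} (t : R) :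
  0 < t -> exists2 d : nat, (1 <= d)%N & t * (1 + ln d%:R) < d%:R.
Proof.
move=> t0; pose n := (Num.truncn (3 * t)).+1; exists (n ^ 2)%N; first by rewrite expn_gt0.
have tn : 3 * t < n%:R by exact: truncnS_gt.
have n1 : 1 <= n%:R :> R by rewrite ler1n.
have n0 : 0 < n%:R :> R by rewrite ltr0n.
have lnn := ln_sublinear n0.
rewrite natrX lnXn // expr2; apply: (@lt_trans _ _ (3 * t * n%:R)); last by rewrite ltr_pM2r.
by rewrite [3 * t]mulrC -mulrA ltr_pM2l //; lra.
Qed.

Lemma SPT_PT {R : realType} (gamma : nat -> R) : SPT gamma -> PT gamma.
Proof.
move=> [C [tau [C0 [tau0 H]]]]; exists C, tau, 0; do 3!split=> //.
by move=> d eps d1 e01; rewrite powRr0 mulr1; exact: H.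
Qed.

Lemma PT_QPT {R : realType} (gamma : nat -> R) : PT gamma -> QPT gamma.
Proof.
move=> [C [tau [sigma [C0 [tau0 [sigma0 H]]]]]]; exists C, (tau + sigma).
do 2!split=> //; first by rewrite ltr_wpDr.
move=> d eps d1 /andP[e0 e1]; have [|N [adm NB]] := H d eps d1; first by rewrite e0.
exists N; split=> //; apply: le_trans NB _.
rewrite -mulrA ler_pM2l // /powR gt_eqF // pnatr_eq0 gtn_eqF // -expRD ler_expR.
rewrite lnV ?posrE //.
have l0 : 0 <= - ln eps by rewrite oppr_ge0 ln_le0 // ltW.
have d0 : 0 <= ln d%:R :> R by rewrite ln_ge0 // ler1n.
have ld0 := mulr_ge0 l0 d0.
(* [h1] and [h2] collect what remains of the expanded QPT exponent after removing
   [tau log (1 / eps)] and [sigma log d]. *)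
have h1 : 0 <= tau * (1 + ln d%:R + - ln eps * ln d%:R) by rewrite mulr_ge0 ?addr_ge0 ?(ltW tau0).
have h2 : 0 <= sigma * (1 + - ln eps + - ln eps * ln d%:R) by rewrite mulr_ge0 ?addr_ge0.
lra.
Qed.

Lemma QPT_eventually_zero {R : realType} (gamma : nat -> R) :
  (forall j, 0 <= gamma j.+1 <= 1) ->
  (forall j, (1 <= j)%N -> gamma j.+1 <= gamma j) ->
  QPT gamma -> exists tau : nat, forall j, (tau < j)%N -> gamma j = 0.
Proof.
move=> g01 gdec [C [t [C0 [t0 H]]]]; apply: contrapT => gnz.
(* By monotonicity one zero weight kills all later ones, so a sequence that is not eventually zero
   is positive throughout. *)
have gpos j : 0 < gamma j.+1.
  have /andP[g0 _] := g01 j; rewrite lt0r g0 andbT; apply/eqP => gj0; apply: gnz.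
  exists j => i; elim: i => // i IHi; rewrite ltnS leq_eqVlt => /orP[/eqP <- //|ji].
  have /andP[gi0 _] := g01 i; apply/eqP; rewrite eq_le gi0 andbT -(IHi ji).
  by apply: gdec; apply: leq_ltn_trans ji.
have [d d1] := linear_gt_log t t0.
by rewrite ltNge (QPT_dim_le g01 C) // => eps; exact: H.
Qed.

Theorem theorem2 (R : realType) (gamma : nat -> R) :
  gamma 1 <= 1 ->
  (forall j, (1 <= j)%N -> gamma j.+1 <= gamma j) ->
  (forall j, (1 <= j)%N -> 0 <= gamma j) ->
  (QPT gamma <-> PT gamma) /\ (PT gamma <-> SPT gamma) /\
  (SPT gamma <-> exists tau : nat, forall j, (tau < j)%N -> gamma j = 0).
Proof.
move=> g1 gdec g0.
have g01 j : 0 <= gamma j.+1 <= 1.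
  rewrite g0 //=; elim: j => // j; apply: le_trans; exact: gdec.
have zero_SPT : (exists tau : nat, forall j, (tau < j)%N -> gamma j = 0) -> SPT gamma.
  by case=> k; exact: eventually_zero_SPT.
have QPT_zero := QPT_eventually_zero gamma g01 gdec.
have SPT_QPT : SPT gamma -> QPT gamma by move=> /SPT_PT /PT_QPT.
split; first by split=> [/QPT_zero /zero_SPT /SPT_PT //|/PT_QPT].
split; first by split=> [/PT_QPT /QPT_zero /zero_SPT //|/SPT_PT].
by split=> [/SPT_QPT /QPT_zero|].
Qed.
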